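(* Let $\mathcal{J},\mathcal{K}$ be ideals on $\omega$. (1) If $\mathcal{I}=\mathcal{J}\otimes\mathcal{K}$, then $\mathfrak{b}(\mathcal{I},\mathcal{I},\mathrm{Fin})=\mathfrak{c}^+$. (2) If $\mathcal{I}=\mathcal{J}\otimes\{\emptyset\}$, then $\mathfrak{b}(\mathcal{I},\mathcal{I},\mathrm{Fin})=\mathfrak{b}(\mathcal{J},\mathcal{J},\mathrm{Fin})$. (3) If $\mathcal{I}=\{\emptyset\}\otimes\mathcal{K}$, then $\mathfrak{b}(\mathcal{I},\mathcal{I},\mathrm{Fin})=\mathfrak{b}(\mathcal{K},\mathcal{K},\mathrm{Fin})$.
   Context: An ideal on a countable infinite set $X$ is a family $\mathcal{I}\subseteq\mathcal{P}(X)$ closed under finite unions and subsets, containing all finite subsets, with $X\notin\mathcal{I}$; $\mathrm{Fin}$ denotes the ideal of finite subsets of the relevant set ($\omega$ or $\omega\times\omega$). For $A\subseteq\omega\times\omega$, $(A)_x=\{y:(x,y)\in A\}$. For ideals $\mathcal{J},\mathcal{K}$ on $\omega$: $\mathcal{J}\otimes\mathcal{K}=\{A\subseteq\omega^2:\{x:(A)_x\notin\mathcal{K}\}\in\mathcal{J}\}$, $\mathcal{J}\otimes\{\emptyset\}=\{A\subseteq\omega^2:\{x:(A)_x\ne\emptyset\}\in\mathcal{J}\}$, $\{\emptyset\}\otimes\mathcal{K}=\{A\subseteq\omega^2:(A)_x\in\mathcal{K}\text{ for all }x\}$. For an ideal $\mathcal{K}$ on $X$, $\widehat{\mathcal{P}}_{\mathcal{K}}$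 is the family of sequences $\langle A_n:n\in\omega\rangle$ of pairwise disjoint members of $\mathcal{K}$, and $\mathcal{P}_{\mathcal{K}}$ those with union $X$. For ideals on $X$: $\mathfrak{b}(\mathcal{I},\mathcal{J},\mathcal{K})=\min\{|\mathcal{E}|:\mathcal{E}\subseteq\widehat{\mathcal{P}}_{\mathcal{K}},\ \forall\langle A_n\rangle\in\mathcal{P}_{\mathcal{J}}\ \exists\langle E_n\rangle\in\mathcal{E}\ \bigcup_n(A_n\cap\bigcup_{i\le n}E_i)\notin\mathcal{I}\}$, with the convention $\min\emptyset=\mathfrak{c}^+$. *)

(* Defs.v *)
From mathcomp Require Import all_boot.
From mathcomp Require Import boolp classical_sets functions cardinality.

Set Implicit Arguments.
Unset Strict Implicit.
Unset Printing Implicit Defensive.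

Local Open Scope classical_set_scope.
Local Open Scope card_scope.

(** A cardinal number is an equipotence class of types, so that equality of
    cardinals is Leibniz equality: see [cardinal_ofP]. *)
Definition cardinal := Type -> Prop.

Definition cardinal_of T (A : set T) : cardinal := fun U => A #= [set: U].

Definition card_lt T U (A : set T) (B : set U) : Prop :=
  A #<= B /\ ~ (B #<= A).

(** A member of [F] of least cardinality; it exists as soon as [F] is nonempty,
    see [card_minP]. *)
Definition card_min T (F : set (set T)) : set T :=
  xget set0 [set A | F A /\ forall B, F B -> A #<= B].

(** The successor of the continuum is realised inside P(P(omega)), which is
    large enough by Cantor's theorem: see [continuum_succP] and
    [continuum_succ_least]. *)
Definition continuum_succ_set : set (set (set nat)) :=
  card_min [set A | card_lt [set: set nat] A].

Definition continuum_succ : cardinal := cardinal_of continuum_succ_set.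

Section Ideals.
Variable X : Type.
Implicit Types I J K : set (set X).

Definition ideal I : Prop :=
  [/\ forall A B, I A -> I B -> I (A `|` B),
      forall A B, A `<=` B -> I B -> I A,
      forall A, finite_set A -> I A
    & ~ I setT].

Definition Fin : set (set X) := [set A | finite_set A].

Definition disjoint_seqs K : set (nat -> set X) :=
  [set A | (forall n, K (A n)) /\ trivIset setT A].

Definition partition_seqs K : set (nat -> set X) :=
  [set A | disjoint_seqs K A /\ \bigcup_n A n = setT].

Definition b_witness I J K : set (set (nat -> set X)) :=
  [set EE | EE `<=` disjoint_seqs K /\
    forall A, partition_seqs J A ->
      exists2 E, EE E &
        ~ I (\bigcup_n (A n `&` \bigcup_(i in [set i | (i <= n)%N]) E i))].

Definition b_number I J K : cardinal :=
  if pselect (b_witness I J K !=set0)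
  then cardinal_of (card_min (b_witness I J K))
  else continuum_succ.

End Ideals.

Arguments Fin X : clear implicits.

Section Products.
Implicit Types J K : set (set nat).

Definition ideal_prod J K : set (set (nat * nat)) :=
  [set A | J [set x | ~ K (xsection A x)]].

Definition ideal_prod_empty J : set (set (nat * nat)) :=
  [set A | J [set x | xsection A x <> set0]].

Definition empty_prod_ideal K : set (set (nat * nat)) :=
  [set A | forall x, K (xsection A x)].

End Products.

Lemma cardinal_ofP T U (A : set T) (B : set U) :
  cardinal_of A = cardinal_of B <-> A #= B.
Proof.
split=> [AB|AB].
  have : cardinal_of B (set_type B) by exact: card_setT_sym.
  by rewrite -AB => /card_eq_trans; apply; exact: card_setT.
apply/funext => V; apply/propext; rewrite /cardinal_of; split.
  by apply: card_eq_trans; rewrite card_eq_sym.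
exact: card_eq_trans.
Qed.

Lemma card_minP T (F : set (set T)) : F !=set0 ->
  F (card_min F) /\ forall B, F B -> card_min F #<= B.
Proof.
move=> [A0 FA0]; apply: (@xgetPex _ set0
  [set A | F A /\ forall B, F B -> A #<= B]).
pose P (D : set (set T -> T)) :=
  (forall f A, D f -> F A -> A (f A)) /\
  (forall f g A, D f -> D g -> F A -> f A = g A -> f = g).
have [C CP Ctot|D [[DF Dinj] Dmax]] := @Zorn_bigcup _ P.
  split=> [f A [D CD Df] FA|f g A [D1 CD1 D1f] [D2 CD2 D2g] FA].
    by have [DF _] := CP _ CD; exact: (DF f A).
  have [D12|D21] := Ctot _ _ CD1 CD2.
    by have [_ inj2] := CP _ CD2; apply: (inj2 f g A) => //; exact: D12.
  by have [_ inj1] := CP _ CD1; apply: (inj1 f g A) => //; exact: D21.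
have [A FA AD] : exists2 A, F A & A `<=` [set f A | f in D].
  apply: contrapT => noA.
  have out A : F A -> exists2 t, A t & ~ [set f A | f in D] t.
    move=> FA; apply: contrapT => nt; apply: noA; exists A => // t At.
    by apply: contrapT => nDt; apply: nt; exists t.
  have [t0 _ _] := out _ FA0.
  have /choice[h hP] : forall A, exists t,
      F A -> A t /\ ~ [set f A | f in D] t.
    move=> A; have [FA|nFA] := pselect (F A); last by exists t0.
    by have [t At nDt] := out _ FA; exists t.
  apply: (Dmax (D `|` [set h])).
    split; first by move=> f; left.
    move=> /(_ h (or_intror erefl)) Dh.
    by have [_] := hP _ FA0; apply; exists h.
  split=> [f A [Df|->] FA|f g A [Df|->] [Dg|->] FA fg].
  - exact: (DF f A).
  - by have [] := hP _ FA.
  - exact: (Dinj f g A).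
  - by have [_] := hP _ FA; case; exists f.
  - by have [_] := hP _ FA; case; exists g.
  - by [].
exists A; split=> // B FB.
apply: (card_le_trans (subset_card_le AD)).
apply: (card_le_trans (card_image_le _ _)).
have Dinj' : {in D &, injective (fun f : set T -> T => f B)}.
  by move=> f g /set_mem Df /set_mem Dg; exact: (Dinj f g B).
rewrite -(card_le_eql (inj_card_eq Dinj')).
by apply: subset_card_le => _ [f Df <-]; exact: (DF f B).
Qed.

Lemma card_le_total T U (A : set T) (B : set U) : A #<= B \/ B #<= A.
Proof.
pose A' : set (T + U) := inl @` A; pose B' : set (T + U) := inr @` B.
have AA' : A' #= A by apply: inj_card_eq => x y _ _ [].
have BB' : B' #= B by apply: inj_card_eq => x y _ _ [].
rewrite -(card_le_eql AA') -(card_le_eqr BB') -(card_le_eqr AA') -(card_le_eql BB').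
have [|[->|->] min] := @card_minP _ [set A'; B'].
- by exists A'; left.
- by left; apply: min; right.
- by right; apply: min; left.
Qed.

Lemma continuum_succP : card_lt [set: set nat] continuum_succ_set.
Proof.
apply: (card_minP _).1; exists setT; split.
  have inj : {in [set: set nat] &, injective (fun x : set nat => [set x])}.
    by move=> x y _ _ /= e; have : [set x] x by []; rewrite e.
  by rewrite -(card_le_eql (inj_card_eq inj)); apply: subset_card_le.
move=> /pcard_leTP[f].
pose D : set (set nat) := [set x | exists2 S : set (set nat), f S = x & ~ S x].
have [Df|nDf] := pselect (D (f D)).
  case: (Df) => S fSD; suff -> : S = D by apply.
  by apply: (@inj _ _ setT f); rewrite ?inE.
by apply: (nDf); exists D.
Qed.

Lemma continuum_succ_least T (B : set T) :
  card_lt [set: set nat] B -> continuum_succ_set #<= B.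
Proof.
move=> [cB Bc]; have [//|BP] := card_le_total continuum_succ_set B.
have /pcard_leP[f] := BP.
have fB : f @` B #= B by apply: inj_card_eq; exact: inj.
rewrite -(card_le_eqr fB).
apply: (card_minP (ex_intro _ _ continuum_succP)).2.
by split; rewrite ?(card_le_eqr fB) ?(card_le_eql fB).
Qed.

(* Main.v *)
Require Import Defs.
From mathcomp Require Import all_boot.
From mathcomp Require Import boolp classical_sets functions cardinality.
From mathcomp Require sequences.

(** If [f : X -> Y] is a Katetov reduction, that is [f @^-1` B] is in [I]
    whenever [B] is in [I'], then [b(I', I', Fin) <= b(I, I, Fin)]: partitions
    of [Y] pull back along [f], and finite sets push forward along [f], their
    images being made disjoint without changing the partial unions. Parts (2)
    and (3) follow because a fibre inclusion and a coordinate projection reduce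
    [J] and [J (x) {0}], resp. [K] and [{0} (x) K], to one another. In part (1)
    the partition of the plane into its vertical lines defeats every sequence of
    finite sets at once, so no witnessing family exists. *)

Set Implicit Arguments.
Unset Strict Implicit.
Unset Printing Implicit Defensive.

Local Open Scope classical_set_scope.
Local Open Scope card_scope.

(** Split off from [ideal] because it is all that the transfer of witnesses asks of the two product
    families. *)
Definition downward_closed X (I : set (set X)) : Prop :=
  forall A B, A `<=` B -> I B -> I A.

Lemma ideal_downward_closed X (I : set (set X)) : ideal I -> downward_closed I.
Proof. by case. Qed.

Lemma ideal_prod_empty_downward_closed J :
  downward_closed J -> downward_closed (ideal_prod_empty J).
Proof.
move=> Jdown A B AB; apply: Jdown => x /= + Bx0; apply.
by rewrite -subset0 => y /(le_xsection AB); rewrite Bx0.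
Qed.

Lemma empty_prod_ideal_downward_closed K :
  downward_closed K -> downward_closed (empty_prod_ideal K).
Proof. by move=> Kdown A B AB KB x; apply: Kdown (KB x); exact: le_xsection. Qed.

Lemma bigcup_le_seqDU X (F : nat -> set X) n :
  \bigcup_(i in [set i | (i <= n)%N]) sequences.seqDU F i =
  \bigcup_(i in [set i | (i <= n)%N]) F i.
Proof.
(* The bound [n.+1] is right because [i < n.+1] converts to [i <= n]. *)
have := sequences.bigsetU_seqDU F n.+1; rewrite -!bigcup_mkord.
by move/esym.
Qed.

Lemma disjoint_seqs_seqDU X (K : set (set X)) (F : nat -> set X) :
  downward_closed K -> (forall n, K (F n)) ->
  disjoint_seqs K (sequences.seqDU F).
Proof.
move=> Kdown KF; split=> [n|]; last exact: sequences.trivIset_seqDU.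
by apply: Kdown (KF n); exact: sequences.subset_seqDU.
Qed.

Lemma partition_seqs_preimage X Y (f : X -> Y) J J' A :
  (forall B, J' B -> J (f @^-1` B)) ->
  partition_seqs J' A -> partition_seqs J (fun n => f @^-1` A n).
Proof.
move=> fJ [[J'A Adisj] Acover]; split; first split.
- by move=> n; apply: fJ.
- by move=> i j _ _ [x [Aix Ajx]]; apply: Adisj => //; exists (f x).
- by rewrite -preimage_bigcup Acover preimage_setT.
Qed.

(** If [x] lies in [E i] and [f x] in [A n], then [f x] also lies in the image of [E i]. So the set
    that [E] makes large for the pulled-back partition is contained in the preimage of the one made
    by the images, which therefore cannot belong to [I']. *)
Lemma b_witness_preimage X Y (f : X -> Y) I I' EE :
  downward_closed I -> (forall B, I' B -> I (f @^-1` B)) ->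
  b_witness I I (Fin X) EE ->
  b_witness I' I' (Fin Y)
    [set sequences.seqDU (fun n => f @` E n) | E in EE].
Proof.
move=> Idown fI [EEfin EEwit]; split=> [_ [E EEE <-]|A I'A].
  apply: disjoint_seqs_seqDU => [B C|n]; first exact: sub_finite_set.
  by apply: finite_image; case: (EEfin _ EEE) => + _; apply.
have [E EEE nIE] := EEwit _ (partition_seqs_preimage fI I'A).
exists (sequences.seqDU (fun n => f @` E n)); first by exists E.
move=> /fI I'E; apply: nIE; apply: Idown I'E => x [n _ [Anfx [i lein Eix]]].
exists n => //; split=> //; rewrite bigcup_le_seqDU.
by exists i => //; exists x.
Qed.

(** Having both directions also settles the default value: witnesses exist on both sides or on
    neither, and in the latter case both numbers are [continuum_succ]. *)
Lemma b_number_eq X Y (I J K : set (set X)) (I' J' K' : set (set Y)) :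
  (forall EE, b_witness I J K EE ->
     exists2 EE', b_witness I' J' K' EE' & EE' #<= EE) ->
  (forall EE', b_witness I' J' K' EE' ->
     exists2 EE, b_witness I J K EE & EE #<= EE') ->
  b_number I J K = b_number I' J' K'.
Proof.
move=> to' from'; rewrite /b_number.
case: pselect => [W|nW]; case: pselect => [W'|nW'] //.
- have [minW leW] := card_minP W; have [minW' leW'] := card_minP W'.
  apply/cardinal_ofP; rewrite card_eq_le; apply/andP; split.
    by have [EE /leW + le] := from' _ minW'; move/card_le_trans; apply.
  by have [EE /leW' + le] := to' _ minW; move/card_le_trans; apply.
- by case: nW'; case: W => EE /to'[EE' ? _]; exists EE'.
- by case: nW; case: W' => EE /from'[EE' ? _]; exists EE'.
Qed.

Lemma b_number_Fin_eq X Y (f : X -> Y) (g : Y -> X)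
    (I : set (set X)) (I' : set (set Y)) :
  downward_closed I -> downward_closed I' ->
  (forall B, I' B -> I (f @^-1` B)) -> (forall B, I B -> I' (g @^-1` B)) ->
  b_number I I (Fin X) = b_number I' I' (Fin Y).
Proof.
move=> Idown I'down fI gI'; apply: b_number_eq => EE EEwit.
  exists [set sequences.seqDU (fun n => f @` E n) | E in EE].
    exact: b_witness_preimage EEwit.
  exact: card_image_le.
exists [set sequences.seqDU (fun n => g @` E n) | E in EE].
  exact: b_witness_preimage EEwit.
exact: card_image_le.
Qed.

Lemma b_witness_ideal_prod J K : ideal J -> ideal K ->
  b_witness (ideal_prod J K) (ideal_prod J K) (Fin (nat * nat)%type) = set0.
Proof.
move=> [_ Jdown Jfin _] [_ Kdown Kfin _]; rewrite -subset0 => EE [EEfin EEwit].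
pose A n : set (nat * nat) := fst @^-1` [set n].
have AP : partition_seqs (ideal_prod J K) A.
  split; [split=> [n|i j _ _ [p [/= <- <-]] //]|].
    (* The line [A n] has an empty section at every [x] other than [n]. *)
    apply: Jdown (Jfin _ (finite_set1 n)) => x /= nKx.
    apply: contrapT => xn; apply: nKx; apply: Kfin.
    suff -> : xsection (A n) x = set0 by exact: finite_set0.
    by rewrite -subset0 => y /xsectionP.
  by apply/seteqP; split=> // p _; exists p.1.
have [E /EEfin[Efin _]] := EEwit _ AP; apply.
(* Over [x] only the line [A x] contributes, so the section is covered by the projections of [E 0],
   ..., [E x] and is finite; no [x] is exceptional. *)
apply: Jdown (Jfin _ (@finite_set0 nat)) => x; apply; apply: Kfin.
apply: (@sub_finite_set _ _ (snd @` \bigcup_(i in `I_x.+1) E i)).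
  by move=> y /xsectionP[n _ [/= <- Ey]]; exists (x, y).
apply/finite_image/bigcup_finite; first exact: finite_II.
by move=> i _; exact: Efin.
Qed.

Theorem theorem5p14 (J K : set (set nat)) (idealJ : ideal J) (idealK : ideal K) :
  [/\ forall I : set (set (nat * nat)), I = ideal_prod J K ->
        b_number I I (Fin (nat * nat)%type) = continuum_succ,
      forall I : set (set (nat * nat)), I = ideal_prod_empty J ->
        b_number I I (Fin (nat * nat)%type) = b_number J J (Fin nat)
    & forall I : set (set (nat * nat)), I = empty_prod_ideal K ->
        b_number I I (Fin (nat * nat)%type) = b_number K K (Fin nat)].
Proof.
have Jdown := ideal_downward_closed idealJ.
have Kdown := ideal_downward_closed idealK.
split=> I ->.
- rewrite /b_number; case: pselect => // -[EE].
  by rewrite b_witness_ideal_prod.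
(* The preimage of [B] under [fst] has nonempty sections only over [B]; conversely, a point of row 0
   in a plane set witnesses a nonempty section. Any row would do. *)
- apply: (@b_number_Fin_eq _ _ fst (fun x => (x, 0%N))) => //.
  + exact: ideal_prod_empty_downward_closed.
  + move=> B; apply: Jdown => x /= nB; apply: contrapT => nBx; apply: nB.
    by rewrite -subset0 => y /xsectionP.
  + move=> B; apply: Jdown => x Bx0 /= Bx.
    by have : xsection B x 0%N by [apply/xsectionP]; rewrite Bx.
(* Every section of the preimage of [B] under [snd] is [B], and pulling back along column 0 yields
   the section at 0. *)
- apply: (@b_number_Fin_eq _ _ snd (fun y => (0%N, y))) => //.
  + exact: empty_prod_ideal_downward_closed.
  + by move=> B KB x; rewrite xsection_preimage_snd.
  + by move=> B /(_ 0%N); rewrite xsectionE.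
Qed.
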